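(* $\mathrm{ex}(n,\{\text{david},\text{nested},\text{crossing}\})\in\Theta(n^2)$.
   Context: Let $P$ be a set of $n$ points in convex position in the plane (the vertices of a convex $n$-gon); a triangle on $P$ is a 3-element subset of $P$. For two distinct triangles $t_1,t_2$ on $P$, label each point of $t_1\cup t_2$ by the triangle(s) containing it and read the points in their cyclic order around the polygon. The pair forms exactly one of eight configurations. (i) If $t_1,t_2$ share two vertices $u,v$: ''taco'' if their third vertices lie on the same side of the line $uv$, ''mariposa'' if on opposite sides. (ii) If they share exactly one vertex $v$: read the remaining four vertices in cyclic order starting just after $v$; ''bat'' if the pattern is $t_1t_1t_2t_2$ or $t_2t_2t_1t_1$, ''nested'' if it is $t_1t_2t_2t_1$ or $t_2t_1t_1t_2$, ''crossing'' if it is $t_1t_2t_1t_2$ or $t_2t_1t_2t_1$. (iii) If they share no vertex, the cyclic sequence of the six labels is, up to rotation, reflection and exchanging the roles of $t_1,t_2$, one of: ''ears'' $AAABBB$, ''swords'' $AABABB$, ''david'' $ABABAB$. For a set $X$ of configurations, $\mathrm{ex}(n,X)$ is the maximum size of a family of triangles on $P$ in which no two triangles form a configuration belonging to $X$ (this depends only on $n$ and $X$). *)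

(* Defs.v *)
From HB Require Import structures.
From mathcomp Require Import all_boot all_order all_algebra finmap.
From mathcomp Require Import boolp classical_sets reals topology normedtype.
From mathcomp Require Import landau.

Set Implicit Arguments.
Unset Strict Implicit.
Unset Printing Implicit Defensive.

Import Order.TTheory GRing.Theory Num.Theory.
Import numFieldNormedType.Exports.

Local Open Scope ring_scope.

Notation plane R := 'rV[R]_2.

(* Twice the signed area of the triangle [a b c]; it is positive iff [a], [b],
   [c] is a counterclockwise turn, and its sign tells on which side of the
   line [a b] the point [c] lies. *)
Definition orient (R : realType) (a b c : plane R) : R :=
  (b 0 0 - a 0 0) * (c 0 1 - a 0 1) - (b 0 1 - a 0 1) * (c 0 0 - a 0 0).

(* No point of [P] is a convex combination of the other points of [P]. *)
Definition convex_position (R : realType) (P : {fset plane R}) : Prop :=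
  forall x : P, ~ exists w : P -> R,
    [/\ forall y, 0 <= w y, w x = 0, \sum_y w y = 1 &
        \sum_y w y *: val y = val x].

Inductive configuration :=
  Taco | Mariposa | Bat | Nested | Crossing | Ears | Swords | David.

(* Equality up to rotation, reflection and exchange of the two labels. *)
Definition same_pattern (l w : bitseq) : Prop :=
  exists (k : nat) (refl exch : bool),
    l = rot k (let w' := if exch then map negb w else w in
               if refl then rev w' else w').

Section Configurations.
Variables (R : realType) (P : {fset plane R}).

(* [s] lists distinct points of [P] in the (counterclockwise) cyclic order in
   which they appear around the polygon: when [P] is in convex position, this
   means that every three of them, taken in the order of [s], make a
   counterclockwise turn. *)
Fixpoint in_cyclic_order (s : seq P) : bool :=
  if s is a :: s' then
    pairwise (fun b c => 0 < orient (val a) (val b) (val c)) s'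
      && in_cyclic_order s'
  else true.

Definition share_two (t1 t2 : {set P}) (side : R -> R -> Prop) : Prop :=
  exists u v a b : P,
    [/\ u != v, t1 :&: t2 = [set u; v],
        t1 :\: t2 = [set a], t2 :\: t1 = [set b] &
        side (orient (val u) (val v) (val a)) (orient (val u) (val v) (val b))].

(* In label sequences, [true] stands for [t1] and [false] for [t2]. *)
Definition share_one (t1 t2 : {set P}) (patterns : seq bitseq) : Prop :=
  exists (v : P) (s : seq P),
    [/\ t1 :&: t2 = [set v],
        perm_eq s (enum ((t1 :|: t2) :\ v)),
        in_cyclic_order (v :: s) &
        [seq x \in t1 | x <- s] \in patterns].

Definition share_none (t1 t2 : {set P}) (pattern : bitseq) : Prop :=
  exists s : seq P,
    [/\ [disjoint t1 & t2],
        perm_eq s (enum (t1 :|: t2)),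
        in_cyclic_order s &
        same_pattern [seq x \in t1 | x <- s] pattern].

Local Notation A := true.
Local Notation B := false.

Definition forms (t1 t2 : {set P}) (c : configuration) : Prop :=
  match c with
  | Taco => share_two t1 t2 (fun x y => 0 < x * y)
  | Mariposa => share_two t1 t2 (fun x y => x * y < 0)
  | Bat => share_one t1 t2 [:: [:: A; A; B; B]; [:: B; B; A; A]]
  | Nested => share_one t1 t2 [:: [:: A; B; B; A]; [:: B; A; A; B]]
  | Crossing => share_one t1 t2 [:: [:: A; B; A; B]; [:: B; A; B; A]]
  | Ears => share_none t1 t2 [:: A; A; A; B; B; B]
  | Swords => share_none t1 t2 [:: A; A; B; A; B; B]
  | David => share_none t1 t2 [:: A; B; A; B; A; B]
  end.

Definition triangle (t : {set P}) : bool := #|t| == 3%N.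

Definition avoids (X : set configuration) (F : {set {set P}}) : Prop :=
  (forall t, t \in F -> triangle t) /\
  (forall t1 t2, t1 \in F -> t2 \in F -> t1 <> t2 ->
     forall c, X c -> ~ forms t1 t2 c).

Definition ex_triangles (X : set configuration) : nat :=
  (\max_(F : {set {set P}} | `[< avoids X F >]) #|F|)%N.

End Configurations.

(* Main.v *)
Require Import Defs.
From mathcomp Require Import all_boot all_order all_algebra finmap.
From mathcomp Require Import boolp classical_sets reals topology normedtype.
From mathcomp Require Import landau.
From mathcomp Require Import zify ring lra.
Import Order.TTheory GRing.Theory Num.Theory numFieldNormedType.Exports.
Local Open Scope ring_scope.

(** In convex position, the other points are linearly ordered by their angle
    around any given point: a violation of transitivity would put that point
    inside a triangle.  Numbering the points in the resulting cyclic order turns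
    the configurations into order patterns of numbers.

    Upper bound: forbidding crossings suffices.  Among the triangles with
    smallest vertex [a], the opposite edges form a graph without two crossing
    edges, which has a linear number of edges; summing over [a] gives [2 n^2].

    Lower bound: with [h = n / 4], the [2 h^2] triangles [{2k, 2k+1, 2h+j}] with
    [k < h] and [j < 2h] avoid all three configurations, since no point lies
    between [2k] and [2k+1]. *)

(** * Convex combinations and orientations in convex position *)

(** Stated for any module so as to give both the total weight (constant [f] in [R^o]) and the
    weighted point. *)
Lemma sum_scale_comb3 (R : fieldType) (I : finType) (V : lmodType R)
    (f : I -> V) (a b c : I) (ka kb kc k : R) :
  \sum_y ((ka * (y == a)%:R + kb * (y == b)%:R + kc * (y == c)%:R) / k) *: f y =
  k^-1 *: (ka *: f a + kb *: f b + kc *: f c).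
Proof.
have sumf d : \sum_y (y == d)%:R *: f y = f d.
  rewrite (bigD1 d) //= eqxx scale1r big1 ?addr0 // => y /negbTE ->.
  by rewrite scale0r.
rewrite -(sumf a) -(sumf b) -(sumf c) !scaler_sumr -!big_split scaler_sumr.
by apply: eq_bigr => y _ /=; rewrite mulrC -scalerA !scalerDl !scalerA.
Qed.

Section ConvexPosition.
Variables (R : realType) (P : {fset plane R}).
Hypothesis convP : convex_position P.

(** The weights are left unnormalised so that determinants can serve directly. Since [a], [b], [c]
    may coincide, points on a segment are covered too. *)
Lemma convex_position_comb3 (x a b c : P) (ka kb kc : R) :
    x != a -> x != b -> x != c -> 0 <= ka -> 0 <= kb -> 0 <= kc ->
    0 < ka + kb + kc ->
    (forall i, (ka + kb + kc) * val x 0 i =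
               ka * val a 0 i + kb * val b 0 i + kc * val c 0 i) ->
  False.
Proof.
set k := ka + kb + kc => xa xb xc ka0 kb0 kc0 k0 xE.
apply: (convP x).
exists (fun y => (ka * (y == a)%:R + kb * (y == b)%:R + kc * (y == c)%:R) / k).
have kN0 : k != 0 by rewrite gt_eqF.
split.
- move=> y; apply: divr_ge0; last exact: ltW.
  by rewrite !addr_ge0 // mulr_ge0 // ler0n.
- by rewrite (negbTE xa) (negbTE xb) (negbTE xc) !mulr0 !addr0 mul0r.
- transitivity (k^-1 * k); last by rewrite mulVf.
  have := @sum_scale_comb3 R _ R^o (fun=> 1) a b c ka kb kc k.
  rewrite /GRing.scale /= !mulr1 => <-.
  by apply: eq_bigr => y _; rewrite mulr1.
- rewrite sum_scale_comb3.
  by apply/rowP => i; rewrite !mxE -xE mulrA mulVf ?mul1r.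
Qed.

Lemma orient_rot (a b c : plane R) : orient a b c = orient b c a.
Proof. rewrite /orient; ring. Qed.

Lemma orient_flip (a b c : plane R) : orient a b c = - orient a c b.
Proof. rewrite /orient; ring. Qed.

Lemma forall_ord2 (Q : 'I_2 -> Prop) : Q 0 -> Q 1 -> forall i, Q i.
Proof.
move=> Q0 Q1 i; case: (unliftP 0 i) => [j|] -> //.
by rewrite (ord1 j); congr Q: Q1; apply/val_inj.
Qed.

(** Of three collinear points, one lies between the other two. *)
Lemma orient_neq0 (a b c : P) : a != b -> a != c -> b != c ->
  orient (val a) (val b) (val c) != 0.
Proof.
move=> ab ac bc; apply/negP => /eqP abc0.
have [ba ca cb] : [/\ b != a, c != a & c != b].
  by rewrite !(eq_sym _ a) (eq_sym c).
have [i abi] : exists i, val a 0 i != val b 0 i.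
  apply/existsP; rewrite -negb_forall; apply: contra ab => /forallP abE.
  by apply/eqP/val_inj/rowP => i; apply/eqP.
(* The parameter of [c] on the line from [a] (value 0) to [b] (value 1), read off a coordinate where
   [a] and [b] differ. Its position relative to 0 and 1 decides which point is the middle one. *)
pose l := (val c 0 i - val a 0 i) / (val b 0 i - val a 0 i).
have bai0 : val b 0 i - val a 0 i != 0 by rewrite subr_eq0 eq_sym.
have cE j : val c 0 j = val a 0 j + l * (val b 0 j - val a 0 j).
  have -> : val c 0 j = val a 0 j + l * (val b 0 j - val a 0 j) +
     (val c 0 j - val a 0 j - l * (val b 0 j - val a 0 j)) by ring.
  suff -> : val c 0 j - val a 0 j - l * (val b 0 j - val a 0 j) = 0 by ring.
  apply: (mulfI bai0); rewrite mulr0 mulrBr mulrA /l (mulrC _ (_ / _)) divfK //.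
  move: abc0; rewrite /orient {abi bai0 l}.
  move: i j; apply: forall_ord2; apply: forall_ord2 => abc0; lra.
have [l0|l0] := ltP l 0.
  apply: (@convex_position_comb3 a c b c 1 (- l) 0) => //; try lra.
  by move=> j; rewrite cE; ring.
have [l1|l1] := leP l 1.
  apply: (@convex_position_comb3 c a b a (1 - l) l 0) => //; try lra.
  by move=> j; rewrite cE; ring.
apply: (@convex_position_comb3 b a c a (l - 1) 1 0) => //; try lra.
by move=> j; rewrite cE; ring.
Qed.

(** Otherwise [o] is inside the triangle [a b c]; the weights are its barycentric coordinates, up to
    scaling. *)
Lemma orient_gt0_trans (o a b c : P) :
    0 < orient (val o) (val a) (val b) -> 0 < orient (val o) (val b) (val c) ->
  o != a -> o != b -> o != c -> a != c ->
  0 < orient (val o) (val a) (val c).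
Proof.
move=> oab obc oNa oNb oNc aNc; rewrite lt_neqAle eq_sym orient_neq0 //=.
rewrite leNgt orient_flip oppr_lt0; apply/negP => oca.
apply: (@convex_position_comb3 o a b c (orient (val o) (val b) (val c))
  (orient (val o) (val c) (val a)) (orient (val o) (val a) (val b))) => //;
  try lra.
by apply: forall_ord2; rewrite /orient; ring.
Qed.

(** Otherwise [b] is inside the triangle [o a c], again by barycentric coordinates. Thus the angular
    order around [o] determines the orientation of triples that avoid [o]. *)
Lemma orient_gt0_fan (o a b c : P) :
    0 < orient (val o) (val a) (val b) -> 0 < orient (val o) (val b) (val c) ->
  0 < orient (val o) (val a) (val c) ->
  o != b -> a != b -> b != c -> a != c ->
  0 < orient (val a) (val b) (val c).
Proof.
move=> oab obc oac oNb aNb bNc aNc; rewrite lt_neqAle eq_sym orient_neq0 //=.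
rewrite leNgt orient_flip oppr_lt0; apply/negP => acb.
apply: (@convex_position_comb3 b o a c (orient (val a) (val c) (val b))
  (orient (val o) (val b) (val c)) (orient (val o) (val a) (val b)));
  rewrite ?(eq_sym b o) ?(eq_sym b a) //; try lra.
by apply: forall_ord2; rewrite /orient; ring.
Qed.

End ConvexPosition.

(** * Existence of the cyclic order *)

Lemma exists_cyclic_order (R : realType) (P : {fset plane R}) :
  convex_position P ->
  exists2 s : seq P, perm_eq s (enum {: P}) & in_cyclic_order s.
Proof.
move=> convP; case E: (enum {: P}) => [|o r]; first by exists [::].
have := enum_uniq {: P}; rewrite E /= => /andP[oNr r_uniq].
pose lt (b c : P) := 0 < orient (val o) (val b) (val c).
(* Angles around [o] compare only points other than [o], hence totality and transitivity relative to
   [Q]. *)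
pose Q : pred P := [pred x | o != x].
have Qr (t : seq P) : perm_eq t r -> all Q t.
  move=> tr; apply/allP => x; rewrite (perm_mem tr) /= => xr.
  by apply: contraNneq oNr => ->.
pose le (b c : P) := (b == c) || lt b c.
have le_total : {in Q &, total le}.
  move=> b c /= ob oc; rewrite /le eq_sym; case: eqVneq => //= cb.
  rewrite /lt (orient_flip _ _ (val c)) oppr_gt0 orbC -neq_lt.
  by rewrite orient_neq0 // eq_sym.
have le_trans : {in Q & &, transitive le}.
  move=> b a c /= ob oa oc; rewrite /le.
  have [-> //|ab] := eqVneq a b; have [<- /= -> |bc /=] := eqVneq b c.
    by rewrite orbT.
  move=> ltab ltbc; case: eqVneq => //= ac.
  exact: (orient_gt0_trans _ _ convP _ _ _ _ ltab ltbc).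
pose s := sort le r.
have sr : perm_eq s r by rewrite perm_sort.
have s_uniq : uniq s by rewrite (perm_uniq sr).
have s_le : pairwise le s.
  rewrite -(sorted_pairwise_in le_trans) ?Qr //.
  by rewrite (sort_sorted_in le_total) // Qr.
have s_lt : pairwise lt s.
  have := s_le; have := s_uniq; rewrite uniq_pairwise => un lep.
  have : pairwise [rel x y | (x != y) && le x y] s by rewrite pairwise_relI un.
  by apply: sub_pairwise => x y /= /andP[/negbTE xy]; rewrite /le xy.
exists (o :: s); first by rewrite perm_cons.
rewrite /= s_lt /= {le_total le_trans s_le}.
(* Triples starting at [o] are settled by the sorting. For the others, a double induction fixes the
   first two points and applies the fan lemma. *)
move: s_uniq s_lt (Qr s sr); elim: {sr}s => //= a t IH /andP[aNt t_uniq].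
move=> /andP[/allP ltat t_lt] /andP[oa ot]; rewrite IH // andbT.
move: ltat aNt t_uniq t_lt ot {IH}; elim: t => //= b t IH ltat.
rewrite inE negb_or => /andP[ab aNt] /andP[bNt t_uniq] /andP[/allP ltbt t_lt].
move=> /andP[ob ot]; rewrite IH ?andbT //; last first.
  by move=> x xt; apply: ltat; rewrite inE xt orbT.
apply/allP => c ct; apply: (orient_gt0_fan _ _ convP o) => //.
- by apply: ltat; rewrite inE eqxx.
- exact: ltbt.
- by apply: ltat; rewrite inE ct orbT.
- by apply: contraNneq bNt => ->.
- by apply: contraNneq aNt => ->.
Qed.


(** * Ranks in the cyclic order, and the upper bound *)

Definition cyclic3 (i j k : nat) : bool :=
  [|| i < j < k, j < k < i | k < i < j]%N.

Lemma cyclic3_total (i j k : nat) :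
  i != j -> j != k -> i != k -> ~~ cyclic3 i k j -> cyclic3 i j k.
Proof. rewrite /cyclic3; lia. Qed.

Section CyclicOrder.
Variables (R : realType) (P : {fset plane R}) (s : seq P).
Hypotheses (perm_s : perm_eq s (enum {: P})) (cyc_s : in_cyclic_order s).

Definition rank (x : P) : nat := index x s.

Let mem_s (x : P) : x \in s.
Proof. by rewrite (perm_mem perm_s) mem_enum. Qed.

Let uniq_s : uniq s.
Proof. by rewrite (perm_uniq perm_s) enum_uniq. Qed.

Let size_s : size s = #|{: P}|.
Proof. by rewrite (perm_size perm_s) cardE. Qed.

Lemma rank_inj : injective rank.
Proof. by move=> x y; apply: (@index_inj _ x s). Qed.

Lemma rank_nth x0 i : (i < #|{: P}|)%N -> rank (nth x0 s i) = i.
Proof. by rewrite -size_s => ?; apply: index_uniq. Qed.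

Lemma pairwise_rank : pairwise (fun x y => rank x < rank y)%N s.
Proof.
case E: s => [|x0 s'] //; rewrite -E; apply/(pairwiseP x0) => i j.
by rewrite /rank !inE => ? ? ?; rewrite !index_uniq.
Qed.

Lemma orient_gt0_rank (x y z : P) : (rank x < rank y < rank z)%N ->
  0 < orient (val x) (val y) (val z).
Proof.
rewrite /rank; move: (mem_s x) (mem_s y) (mem_s z) cyc_s uniq_s.
elim: s => //= a t IH; rewrite !inE ![a == _]eq_sym.
have [-> _ yt zt|xa /= xt] := eqVneq x a.
  move: yt zt; have [//|_ /= yt] := eqVneq y a.
  have [//|_ /= zt] := eqVneq z a.
  case/andP => pw _ _; rewrite ltnS => yz.
  have := pairwiseP y pw (index y t) (index z t).
  by rewrite !inE !index_mem !nth_index //; apply.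
have [//|_ /= yt] := eqVneq y a.
have [|_ /= zt] := eqVneq z a; first by rewrite ltn0 andbF.
by move=> /andP[_ ct] /andP[_ ut]; rewrite !ltnS; apply: IH.
Qed.

(** From here on, geometry is arithmetic on ranks. For the converse, coinciding points give
    determinant zero and the opposite cyclic order gives a negative one. *)
Lemma orient_gt0E (x y z : P) :
  (0 < orient (val x) (val y) (val z)) = cyclic3 (rank x) (rank y) (rank z).
Proof.
have pos u v w : cyclic3 (rank u) (rank v) (rank w) ->
    0 < orient (val u) (val v) (val w).
  by case/or3P => ?; [|rewrite orient_rot|rewrite -orient_rot];
    apply: orient_gt0_rank.
apply/idP/idP => [xyz|]; last exact: pos.
have orient_xxy (u v : plane R) : orient u u v = 0 by rewrite /orient; ring.
have orient_xyy (u v : plane R) : orient u v v = 0 by rewrite /orient; ring.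
apply: cyclic3_total.
- by apply: contraTneq xyz => /rank_inj ->; rewrite orient_xxy ltxx.
- by apply: contraTneq xyz => /rank_inj ->; rewrite orient_xyy ltxx.
- by apply: contraTneq xyz => /rank_inj ->; rewrite orient_rot orient_xyy ltxx.
- by apply: contraTN xyz => /pos; rewrite orient_flip oppr_gt0 -leNgt => /ltW.
Qed.

(** Filtering [s], which is sorted by rank, gives a canonical increasing list of the vertices. *)
Lemma triangle_filter (t : {set P}) : triangle t -> exists a b c : P,
  [/\ [seq x <- s | x \in t] = [:: a; b; c], (rank a < rank b)%N,
      (rank b < rank c)%N & forall x, (x \in t) = (x \in [:: a; b; c])].
Proof.
rewrite /triangle => /eqP t3.
have memf x : (x \in [seq x <- s | x \in t]) = (x \in t).
  by rewrite mem_filter mem_s andbT.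
have sizef : size [seq x <- s | x \in t] = 3%N.
  rewrite -t3 cardE; apply: perm_size; apply: uniq_perm.
  - exact: filter_uniq.
  - exact: enum_uniq.
  - by move=> x; rewrite memf mem_enum.
have := pairwise_filter (fun x => x \in t) pairwise_rank.
move: sizef memf.
case: [seq x <- s | x \in t] => [|a [|b [|c [|d r]]]] //= _ memf.
by case/and3P => /and3P[ab _ _] /andP[bc _] _;
  exists a, b, c; split=> // x; rewrite memf.
Qed.

(** The case of a crossing whose common vertex has the smallest rank, as the upper bound
    requires. *)
Lemma crossing_ranks (t1 t2 : {set P}) (a b1 b2 c1 c2 : P) :
    (forall x, (x \in t1) = (x \in [:: a; b1; c1])) ->
    (forall x, (x \in t2) = (x \in [:: a; b2; c2])) ->
    (rank a < rank b1)%N -> (rank b1 < rank b2)%N -> (rank b2 < rank c1)%N ->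
    (rank c1 < rank c2)%N ->
  forms t1 t2 Crossing.
Proof.
move=> t1E t2E ab1 b12 bc c12.
have neq x y : (rank x < rank y)%N -> (x == y = false) * (y == x = false).
  by move=> xy; split; apply: contraTF xy => /eqP ->; rewrite ltnn.
(* The disequalities of all ten pairs among the five points, as one rewriting rule. *)
have E := ((neq _ _ ab1), (neq _ _ b12), (neq _ _ bc), (neq _ _ c12),
  (neq _ _ (ltn_trans ab1 b12)), (neq _ _ (ltn_trans b12 bc)),
  (neq _ _ (ltn_trans bc c12)), (neq _ _ (ltn_trans b12 (ltn_trans bc c12))),
  (neq _ _ (ltn_trans ab1 (ltn_trans b12 bc))),
  (neq _ _ (ltn_trans ab1 (ltn_trans b12 (ltn_trans bc c12))))).
exists a, [:: b1; b2; c1; c2]; split.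
- apply/setP => x; rewrite !finset.inE t1E t2E !seq.inE.
  case: (eqVneq x a) => //= _; case: (eqVneq x b1) => [->|_] /=.
    by rewrite !E.
  by case: (eqVneq x c1) => [->|_] //=; rewrite !E.
- apply: uniq_perm; rewrite ?enum_uniq //= ?seq.inE ?E // => x.
  rewrite mem_enum !finset.inE t1E t2E !seq.inE.
  case: (eqVneq x a) => [->|_] /=; first by rewrite !E.
  by case: (x == b1); case: (x == b2); case: (x == c1); case: (x == c2).
- rewrite /= !orient_gt0E /cyclic3; move: ab1 b12 bc c12.
  move: (rank a) (rank b1) (rank b2) (rank c1) (rank c2); clear; lia.
- by rewrite /= !t1E !seq.inE !E !eqxx.
Qed.

(* Send [t = {a < b < c}] to [(a, b)] if [c] is maximal in [F] for these [a]
   and [b], and to [(a, c)] otherwise.  If [{a, b, c}] and [{a, b', c}] with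
   [b < b'] are both of the second kind, then [{a, b, c}] crosses some
   [{a, b', c'}] with [c < c']. *)
Lemma card_avoids_crossing (X : set configuration) (F : {set {set P}}) :
  X Crossing -> avoids X F -> (#|F| <= 2 * #|{: P}| ^ 2)%N.
Proof.
move=> XC [triF avF].
have [F0|[t0 t0F]] := set_0Vmem F; first by rewrite F0 cards0.
have [x0 _] := triangle_filter _ (triF _ t0F).
(* [v k t] is the vertex of [t] in position [k] by rank; [x0] is only the default of [nth]. *)
have [v vP] : exists v : nat -> {set P} -> P, forall t, t \in F ->
    [/\ (rank (v 0%N t) < rank (v 1%N t))%N,
        (rank (v 1%N t) < rank (v 2%N t))%N &
        forall x, (x \in t) = (x \in [:: v 0%N t; v 1%N t; v 2%N t])].
  exists (fun k (t : {set P}) => nth x0 [seq x <- s | x \in t] k) => t.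
  move=> /triF/triangle_filter[a [b [c [E ab bc tE]]]].
  by rewrite E /=; split; [exact: ab|exact: bc|exact: tE].
have [top topP topPn] : exists2 top : {set P} -> bool,
    forall t t', top t -> t' \in F -> v 0%N t' = v 0%N t ->
      v 1%N t' = v 1%N t -> (rank (v 2%N t') <= rank (v 2%N t))%N &
    forall t, ~~ top t -> exists t', [/\ t' \in F, v 0%N t' = v 0%N t,
      v 1%N t' = v 1%N t & (rank (v 2%N t) < rank (v 2%N t'))%N].
  exists (fun t => [forall t' in F, ((v 0%N t' == v 0%N t) &&
    (v 1%N t' == v 1%N t)) ==> (rank (v 2%N t') <= rank (v 2%N t))%N]).
    by move=> t t' /forall_inP tP /tP + e0 e1; rewrite e0 e1 !eqxx.
  move=> t /forall_inPn[t' t'F]; rewrite negb_imply -ltnNge.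
  by case/andP=> /andP[/eqP ? /eqP ?] ?; exists t'.
pose key t := (top t, (v 0%N t, if top t then v 1%N t else v 2%N t)).
have inj_v t1 t2 : t1 \in F -> t2 \in F -> v 0%N t1 = v 0%N t2 ->
    v 1%N t1 = v 1%N t2 -> v 2%N t1 = v 2%N t2 -> t1 = t2.
  move=> /vP[_ _ t1E] /vP[_ _ t2E] e0 e1 e2.
  by apply/setP => x; rewrite t1E t2E e0 e1 e2.
have inj_low t1 t2 : t1 \in F -> t2 \in F -> ~~ top t2 -> v 0%N t1 = v 0%N t2 ->
    v 2%N t1 = v 2%N t2 -> (rank (v 1%N t2) <= rank (v 1%N t1))%N.
  move=> F1 F2 /topPn[t3 [F3 e0 e1 lt3]] f0 f2.
  rewrite leqNgt; apply/negP => lt12.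
  have [ab1 bc1 E1] := vP _ F1; have [ab2 bc2 E2] := vP _ F2.
  have [ab3 bc3 E3] := vP _ F3.
  have cross : forms t1 t3 Crossing.
    rewrite e0 -f0 e1 in E3.
    by apply: (crossing_ranks _ _ _ _ _ _ _ E1 E3 ab1 lt12); rewrite f2.
  case: (avF t1 t3 F1 F3 _ _ XC cross) => t13.
  by move: lt3 lt12; rewrite -f2 -t13 ltnn.
have key_inj : {in F &, injective key}.
  move=> t1 t2 F1 F2 [top12 e0]; rewrite top12.
  case: ifP => top2 e1.
    apply: inj_v => //; apply: rank_inj; apply/eqP; rewrite eqn_leq.
    by rewrite !topP ?top12.
  apply: inj_v => //; apply: rank_inj; apply/eqP; rewrite eqn_leq.
  by rewrite !inj_low ?top12 ?top2.
(* Keys consist of a boolean and two points, whence the factor 2. *)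
rewrite -(card_in_imset key_inj) (leq_trans (max_card _)) //.
by rewrite !card_prod card_bool mulnn.
Qed.

End CyclicOrder.

Arguments rank {R P} s x.

(** * The lower-bound construction *)

Definition pair_apex (h k j i : nat) : bool :=
  [|| i == k.*2, i == k.*2.+1 | i == h.*2 + j]%N.

(** The five numbers are distinct, so [v] must be the common apex, above both pairs. Then [x2] would
    lie strictly between the consecutive numbers [x1] and [x3]. *)
Lemma pair_apex_crossing (h k1 j1 k2 j2 v x1 x2 x3 x4 : nat) :
    (k1 < h)%N -> (k2 < h)%N ->
    pair_apex h k1 j1 v -> pair_apex h k1 j1 x1 -> pair_apex h k1 j1 x3 ->
    pair_apex h k2 j2 v -> pair_apex h k2 j2 x2 -> pair_apex h k2 j2 x4 ->
    cyclic3 v x1 x2 -> cyclic3 v x2 x3 -> cyclic3 v x3 x4 ->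
  False.
Proof.
rewrite /cyclic3 /pair_apex.
by move=> ? ? /or3P[]/eqP-> /or3P[]/eqP-> /or3P[]/eqP->; lia.
Qed.

(** Again [v] is the common apex, and now [x2] and [x3] would lie between the consecutive numbers
    [x1] and [x4]. *)
Lemma pair_apex_nested (h k1 j1 k2 j2 v x1 x2 x3 x4 : nat) :
    (k1 < h)%N -> (k2 < h)%N ->
    pair_apex h k1 j1 v -> pair_apex h k1 j1 x1 -> pair_apex h k1 j1 x4 ->
    pair_apex h k2 j2 v -> pair_apex h k2 j2 x2 -> pair_apex h k2 j2 x3 ->
    cyclic3 v x1 x2 -> cyclic3 v x2 x3 -> cyclic3 v x3 x4 ->
  False.
Proof.
rewrite /cyclic3 /pair_apex.
by move=> ? ? /or3P[]/eqP-> /or3P[]/eqP-> /or3P[]/eqP->; lia.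
Qed.

(** Alternation puts a vertex of the second triangle on each arc between two vertices of the first,
    but one arc between [2 * k1] and [2 * k1 + 1] is empty. *)
Lemma pair_apex_david (h k1 j1 k2 j2 x1 x2 x3 x4 x5 x6 : nat) :
    (k1 < h)%N -> (k2 < h)%N ->
    pair_apex h k1 j1 x1 -> pair_apex h k1 j1 x3 -> pair_apex h k1 j1 x5 ->
    pair_apex h k2 j2 x2 -> pair_apex h k2 j2 x4 -> pair_apex h k2 j2 x6 ->
    cyclic3 x1 x2 x3 -> cyclic3 x1 x3 x4 -> cyclic3 x1 x4 x5 ->
    cyclic3 x1 x5 x6 ->
  False.
Proof.
rewrite /cyclic3 /pair_apex.
by move=> ? ? /or3P[]/eqP-> /or3P[]/eqP-> /or3P[]/eqP->; lia.
Qed.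

Lemma same_pattern_alternating (l : bitseq) :
    same_pattern l [:: true; false; true; false; true; false] ->
  l = [:: true; false; true; false; true; false] \/
  l = [:: false; true; false; true; false; true].
Proof.
move=> [k [refl [exch ->]]].
(* Rotating by 6 or more leaves a word of length 6 unchanged, so seven cases for [k] suffice. *)
by case: refl; case: exch; case: k => [|[|[|[|[|[|k]]]]]]; auto.
Qed.

Lemma card_eq_size (T : finType) (A : {set T}) (r : seq T) :
  uniq r -> A =i r -> #|A| = size r.
Proof. by move=> /card_uniqP <- /eq_card. Qed.

Section LowerBound.
Variables (R : realType) (P : {fset plane R}) (s : seq P).
Hypotheses (perm_s : perm_eq s (enum {: P})) (cyc_s : in_cyclic_order s).

Definition pair_apex_triangle (h k j : nat) : {set P} :=
  [set x | pair_apex h k j (rank s x)].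

Lemma mem_pair_apex_triangle h k j x :
  (x \in pair_apex_triangle h k j) = pair_apex h k j (rank s x).
Proof. by rewrite finset.inE. Qed.

(** A false label only denies membership in [t1]; the [all] clause turns it into membership in
    [t2]. *)
Lemma share_one_labels (t1 t2 : {set P}) (patterns : seq bitseq) :
    share_one t1 t2 patterns ->
  exists (v : P) (r : seq P), [/\ v \in t1, v \in t2,
    in_cyclic_order (v :: r),
    all (fun x => x \in (if x \in t1 then t1 else t2)) r &
    [seq x \in t1 | x <- r] \in patterns].
Proof.
move=> [v [r [t12 perm_r cyc_r lab]]].
have vt x : (x \in t1) && (x \in t2) = (x == v).
  by rewrite -finset.in_setI t12 finset.in_set1.
have /andP[v1 v2] : (v \in t1) && (v \in t2) by rewrite vt.
exists v, r; split=> //; apply/allP => x; rewrite (perm_mem perm_r) mem_enum.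
rewrite finset.in_setD1 finset.in_setU => /andP[xv].
by case: ifP.
Qed.

Lemma share_none_labels (t1 t2 : {set P}) (pattern : bitseq) :
    share_none t1 t2 pattern ->
  exists r : seq P, [/\ in_cyclic_order r,
    all (fun x => x \in (if x \in t1 then t1 else t2)) r &
    same_pattern [seq x \in t1 | x <- r] pattern].
Proof.
move=> [r [_ perm_r cyc_r lab]].
exists r; split=> //; apply/allP => x.
rewrite (perm_mem perm_r) mem_enum finset.in_setU.
by case: ifP.
Qed.

Lemma in_cyclic_order_sorted (a : P) (r : seq P) : in_cyclic_order (a :: r) ->
  sorted (fun y z => cyclic3 (rank s a) (rank s y) (rank s z)) r.
Proof.
case/andP => /pairwise_sorted + _; apply: sub_sorted => y z.
by rewrite (orient_gt0E _ _ _ perm_s cyc_s).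
Qed.

Lemma pair_apex_triangles_avoid (h k1 j1 k2 j2 : nat) (c : configuration) :
    (k1 < h)%N -> (k2 < h)%N -> [set David; Nested; Crossing]%classic c ->
  ~ forms (pair_apex_triangle h k1 j1) (pair_apex_triangle h k2 j2) c.
Proof.
move=> k1h k2h.
set t1 := pair_apex_triangle h k1 j1; set t2 := pair_apex_triangle h k2 j2.
have t1P x : x \in t1 -> pair_apex h k1 j1 (rank s x).
  by rewrite mem_pair_apex_triangle.
have t2P x : x \in t2 -> pair_apex h k2 j2 (rank s x).
  by rewrite mem_pair_apex_triangle.
case=> [[]|] ->.
- move=> /share_none_labels[r [cyc_r r12 /same_pattern_alternating lab]].
  have : size r = 6%N.
    by rewrite -(size_map (fun x => x \in t1)); case: lab => ->.
  case: r cyc_r r12 lab => [|x1 [|x2 [|x3 [|x4 [|x5 [|x6 [|x7 r]]]]]]] //.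
  move=> /in_cyclic_order_sorted/and5P[c12 c23 c34 c45 _] + + _ /=.
  move=> + [] [e1 e2 e3 e4 e5 e6]; rewrite /= e1 e2 e3 e4 e5 e6 /= andbT.
    case/and5P => /t1P p1 /t2P p2 /t1P p3 /t2P p4 /andP[/t1P p5 /t2P p6].
    exact: (pair_apex_david h k1 j1 k2 j2 _ _ _ _ _ _ k1h k2h
      p1 p3 p5 p2 p4 p6).
  (* When the labels start with [false], the same arithmetic applies with the two triangles
     exchanged. *)
  case/and5P => /t2P p1 /t1P p2 /t2P p3 /t1P p4 /andP[/t2P p5 /t1P p6].
  exact: (pair_apex_david h k2 j2 k1 j1 _ _ _ _ _ _ k2h k1h p1 p3 p5 p2 p4 p6).
- move=> /share_one_labels[v [r [/t1P v1 /t2P v2 cyc_r r12]]].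
  rewrite !seq.inE => lab.
  have : size r = 4%N.
    by rewrite -(size_map (fun x => x \in t1)); case/orP: lab => /eqP ->.
  case: r cyc_r r12 lab => [|x1 [|x2 [|x3 [|x4 [|x5 r]]]]] //.
  move=> /in_cyclic_order_sorted/and4P[c12 c23 c34 _] + + _ /=.
  move=> + /orP[] /eqP[e1 e2 e3 e4]; rewrite /= e1 e2 e3 e4 /= andbT.
    case/and4P => /t1P p1 /t2P p2 /t2P p3 /t1P p4.
    exact: (pair_apex_nested h k1 j1 k2 j2 _ _ _ _ _ k1h k2h v1 p1 p4 v2 p2 p3).
  case/and4P => /t2P p1 /t1P p2 /t1P p3 /t2P p4.
  exact: (pair_apex_nested h k2 j2 k1 j1 _ _ _ _ _ k2h k1h v2 p1 p4 v1 p2 p3).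
- move=> /share_one_labels[v [r [/t1P v1 /t2P v2 cyc_r r12]]].
  rewrite !seq.inE => lab.
  have : size r = 4%N.
    by rewrite -(size_map (fun x => x \in t1)); case/orP: lab => /eqP ->.
  case: r cyc_r r12 lab => [|x1 [|x2 [|x3 [|x4 [|x5 r]]]]] //.
  move=> /in_cyclic_order_sorted/and4P[c12 c23 c34 _] + + _ /=.
  move=> + /orP[] /eqP[e1 e2 e3 e4]; rewrite /= e1 e2 e3 e4 /= andbT.
    case/and4P => /t1P p1 /t2P p2 /t1P p3 /t2P p4.
    exact: (pair_apex_crossing h k1 j1 k2 j2 _ _ _ _ _ k1h k2h
      v1 p1 p3 v2 p2 p4).
  case/and4P => /t2P p1 /t1P p2 /t2P p3 /t1P p4.
  exact: (pair_apex_crossing h k2 j2 k1 j1 _ _ _ _ _ k2h k1h v2 p1 p3 v1 p2 p4).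
Qed.

Lemma card_pair_apex_triangle (h k j : nat) :
  (k < h)%N -> (j < h.*2)%N -> (4 * h <= #|{: P}|)%N ->
  #|pair_apex_triangle h k j| = 3%N.
Proof.
move=> kh jh hP.
(* A default for [nth]: [k < h] forces [P] to be nonempty. *)
have [x0 _|P0] := pickP (mem {: P}); last first.
  by exfalso; move: kh hP; rewrite (eq_card0 P0); clear; lia.
have [lt1 lt2 lt3] : [/\ k.*2 < #|{: P}|, k.*2.+1 < #|{: P}|
    & h.*2 + j < #|{: P}|]%N.
  by move: kh jh hP; move: #|_| => n; clear; split; lia.
pose r := [:: nth x0 s k.*2; nth x0 s k.*2.+1; nth x0 s (h.*2 + j)].
have rank_r : map (rank s) r = [:: k.*2; k.*2.+1; h.*2 + j]%N.
  by rewrite /= !rank_nth.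
have uniq_r : uniq r.
  apply: (@map_uniq _ _ (rank s)); rewrite rank_r /= !seq.inE.
  by move: kh; clear; lia.
apply: (card_eq_size _ _ r uniq_r) => x.
rewrite mem_pair_apex_triangle -(mem_map (rank_inj _ _ _ perm_s)) rank_r.
by rewrite !seq.inE.
Qed.

Lemma pair_apex_triangle_inj (h k1 j1 k2 j2 : nat) :
    (4 * h <= #|{: P}|)%N -> (k1 < h)%N -> (k2 < h)%N ->
    (j1 < h.*2)%N -> (j2 < h.*2)%N ->
  pair_apex_triangle h k1 j1 = pair_apex_triangle h k2 j2 ->
  k1 = k2 /\ j1 = j2.
Proof.
move=> hP k1h k2h j1h j2h /setP t12.
have [x0 _|P0] := pickP (mem {: P}); last first.
  by exfalso; move: k1h hP; rewrite (eq_card0 P0); clear; lia.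
have t12P i : (i < #|{: P}|)%N -> pair_apex h k1 j1 i = pair_apex h k2 j2 i.
  move=> iP; have := t12 (nth x0 s i).
  by rewrite !mem_pair_apex_triangle rank_nth.
(* Testing at [2 * k1] gives [k1 = k2] by parity; testing at [2 * h + j1], which is above every
   pair, gives [j1 = j2]. *)
move: (t12P k1.*2) (t12P (h.*2 + j1)%N) k1h k2h j1h j2h hP.
rewrite /pair_apex; clear; move: #|_| => n; lia.
Qed.

Lemma exists_avoiding_family (h : nat) : (4 * h <= #|{: P}|)%N ->
  exists2 F : {set {set P}}, avoids [set David; Nested; Crossing]%classic F &
    #|F| = (2 * h ^ 2)%N.
Proof.
move=> hP.
pose f (u : 'I_h * 'I_h.*2) := pair_apex_triangle h u.1 u.2.
have f_inj : injective f.
  move=> [k1 j1] [k2 j2] /pair_apex_triangle_inj[] // e1 e2.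
  by congr pair; apply: val_inj.
exists [set f u | u : 'I_h * 'I_h.*2]; last first.
  by rewrite card_imset // card_prod !card_ord; lia.
split=> [t /imsetP[u _ ->]|t1 t2 /imsetP[u _ ->] /imsetP[w _ ->] _ c Xc].
  by rewrite /triangle card_pair_apex_triangle.
exact: pair_apex_triangles_avoid.
Qed.

End LowerBound.

(** * Quadratic bounds and the asymptotic statement *)

Lemma ex_triangles_bounds (R : realType) (P : {fset plane R}) (n : nat) :
    convex_position P -> #|` P| = n -> (4 <= n)%N ->
  (n ^ 2 <= 32 * ex_triangles P [set David; Nested; Crossing]%classic)%N /\
  (ex_triangles P [set David; Nested; Crossing]%classic <= 2 * n ^ 2)%N.
Proof.
rewrite cardfE => /exists_cyclic_order[s perm_s cyc_s] <- n4; split.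
  have [|F avF cardF] :=
    exists_avoiding_family _ _ s perm_s cyc_s (#|{: P}| %/ 4).
    by rewrite mulnC leq_divM.
  have : (#|F| <= ex_triangles P [set David; Nested; Crossing]%classic)%N.
    by apply: leq_bigmax_cond; apply/asboolP.
  rewrite cardF; move: n4; move: #|_| (ex_triangles _ _) => m e; clear.
  (* With [q = m %/ 4] at least 1, [m < 4 * q + 4 <= 8 * q], so
     [m ^ 2 <= 64 * q ^ 2 = 32 * (2 * q ^ 2)]. This is the source of the constant 32. *)
  move=> m4 le_e; have {m4} : (m <= 8 * (m %/ 4))%N by lia.
  by move: (m %/ 4)%N le_e => h; nia.
apply/bigmax_leqP => F /asboolP; apply: card_avoids_crossing perm_s cyc_s _ _ _.
by right.
Qed.

Theorem theorem19 (R : realType) (P : nat -> {fset plane R})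
    (card_P : forall n, #|` P n| = n)
    (convex_P : forall n, convex_position (P n)) :
  (fun n => (ex_triangles (P n) [set David; Nested; Crossing]%classic)%:R : R)
    \is 'Theta_(\oo%classic)(fun n : nat => n%:R ^+ 2 : R).

Proof.
rewrite qualifE; apply/asboolP; exists (32^-1, 2) => /=; first by lra.
(* The threshold 4 makes [n %/ 4] positive, as the lower bound requires. *)
exists 4%N => // n /= n4.
have [lo up] := ex_triangles_bounds _ _ _ (convex_P n) (card_P n) n4.
rewrite !ger0_norm ?exprn_ge0 ?ler0n // ler_pdivrMl // -natrX -!natrM !ler_nat.
by split.
Qed.
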